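(* Let $\sigma$ be an admissible function (as defined in the context) on a measurable domain $\Omega\subset\mathbb{R}^d$, $d\ge1$. Then for any nonnegative function $f\in L^1(\Omega)$, the function $f^{*\sigma}$ is equimeasurable to $f$, that is $$f^*=(f^{*\sigma})^*,\quad\text{or equivalently}\quad \mu_f=\mu_{f^{*\sigma}}.$$ Moreover, $f^{*\sigma}$ is the only (up to equality almost everywhere) nonnegative function of $L^1(\Omega)$ which is a nonincreasing function of $\sigma(x)$ and is equimeasurable with $f$.
   Context: $\mathrm{meas}$ denotes Lebesgue measure on $\mathbb{R}^d$; $\Omega$ may have infinite measure. For a nonnegative $q\in L^1(\Omega)$: $\mu_q(t)=\mathrm{meas}\{x\in\Omega:\ q(x)>t\}$ for $t\ge0$; $q^\sharp(s)=\inf\{t\ge0:\ \mu_q(t)\le s\}$ for $s\ge0$, with $q^\sharp(0)=\|q\|_{L^\infty}\in[0,+\infty]$ and $q^\sharp(+\infty)=0$; $q^*(x)=q^\sharp(\mathrm{meas}(B_d(0,|x|)\cap\Omega))$, $x\in\Omega$, where $B_d(0,r)$ is the ball of $\mathbb{R}^d$ centered at $0$ with radius $r$. Two functions $f,g$ are equimeasurable if $\mu_f=\mu_g$ on $[0,+\infty)$. For a measurable $\sigma:\Omega\to\mathbb{R}$ put $a_\sigma(e)=\mathrm{meas}\{x\in\Omega:\ \sigma(x)<e\}\in[0,\mathrm{meas}(\Omega)]$ for $e\in\mathbb{R}$. The function $\sigma$ is called admissible if: the set $\{e\in\mathbb{R}: a_\sigma(e)<\mathrm{meas}(\Omega)\}$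 is nonempty; $e_{min}:=\operatorname{ess\,inf}\sigma<e_{max}:=\sup\{e\in\mathbb{R}:\ a_\sigma(e)<\mathrm{meas}(\Omega)\}$ (where $e_{min}=-\infty$ and $e_{max}=+\infty$ are allowed); $\mathrm{meas}\{x\in\Omega:\ \sigma(x)=e\}=0$ for all $e\in\,]-\infty,e_{max}[$; and $\lim_{e\to e_{max},\,e<e_{max}}a_\sigma(e)=\mathrm{meas}(\Omega)$. For such $\sigma$, the $\sigma$-rearrangement of a nonnegative $f\in L^1(\Omega)$ is $f^{*\sigma}(x)=f^\sharp(a_\sigma(\sigma(x)))\,\mathbf{1}_{\sigma(x)<e_{max}}$, $x\in\Omega$. A function $g$ on $\Omega$ is a nonincreasing function of $\sigma(x)$ if $g(x)=F(\sigma(x))$ for some nonincreasing function $F$ on $\mathbb{R}$. *)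

(* Defs.v *)
From HB Require Import structures.
From mathcomp Require Import all_boot all_order all_algebra.
From mathcomp Require Import all_classical all_reals all_analysis.
From mathcomp Require Import ess_sup_inf.

Set Implicit Arguments.
Unset Strict Implicit.
Unset Printing Implicit Defensive.

Import Order.TTheory GRing.Theory Num.Theory.
Import numFieldNormedType.Exports.

Local Open Scope classical_set_scope.
Local Open Scope ring_scope.
Local Open Scope ereal_scope.

(* Throughout, [Rd R d] is R^d with Lebesgue measure [leb R d]: the Caratheodory
   restriction of the outer measure generated by the volume of half-open boxes.
   Its measurable sets are exactly the Lebesgue measurable ones, so the measure
   is complete. *)
Section lebesgue_measure_Rd.
Variables (R : realType) (d : nat).

Definition box (I : 'rV[R]_d * 'rV[R]_d) : set 'rV[R]_d :=
  [set x | forall i, (I.1 ord0 i < x ord0 i <= I.2 ord0 i)%R].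

Definition box_volume (I : 'rV[R]_d * 'rV[R]_d) : \bar R :=
  (\prod_(i < d) Num.max 0 (I.2 ord0 i - I.1 ord0 i))%:E.

(* [None] stands for the empty set, so that a cover may be finite. *)
Definition obox := oapp box set0.
Definition ovolume := oapp box_volume 0.

Definition box_cover (A : set 'rV[R]_d)
    : set (nat -> option ('rV[R]_d * 'rV[R]_d)) :=
  [set I | A `<=` \bigcup_k obox (I k)].

Definition lebesgue_outer (A : set 'rV[R]_d) : \bar R :=
  ereal_inf [set \sum_(k <oo) ovolume (I k) | I in box_cover A].

Let ovolume_ge0 I : 0 <= ovolume I.
Proof.
case: I => [I|]//=; rewrite lee_fin prodr_ge0// => i _.
by rewrite le_max lexx.
Qed.

Let lebesgue_outer_ge0 A : 0 <= lebesgue_outer A.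
Proof. by apply: le_ereal_inf_tmp => _ [I _ <-]; exact: nneseries_ge0. Qed.

Let lebesgue_outer0 : lebesgue_outer set0 = 0.
Proof.
apply/eqP; rewrite eq_le lebesgue_outer_ge0 andbT.
apply: ereal_inf_lbound; exists (fun=> None); first exact: sub0set.
by rewrite eseries0.
Qed.

Let le_lebesgue_outer : {homo lebesgue_outer : A B / A `<=` B >-> A <= B}.
Proof.
move=> A B AB; apply/ereal_inf_le_tmp => _ [I BI <-].
by exists I => //; exact: subset_trans AB BI.
Qed.

Let lebesgue_outer_sigma_subadditive : sigma_subadditive lebesgue_outer.
Proof.
move=> A; have [[i ioo]|] := pselect (exists i, lebesgue_outer (A i) = +oo).
  rewrite (eseries_pinfty _ _ ioo) ?leey// => n _.
  by rewrite -ltNye (lt_le_trans _ (lebesgue_outer_ge0 _)).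
rewrite -forallNE => Aoo.
apply/lee_addgt0Pr => _/posnumP[e].
rewrite (le_trans _ (epsilon_trick _ _ _))//.
pose P n I := box_cover (A n) I /\ \sum_(k <oo) ovolume (I k) <=
  lebesgue_outer (A n) + (e%:num / (2 ^ n.+1)%:R)%:E.
have [G PG] : {G & forall n, P n (G n)}.
  apply: (@choice _ _ P) => n.
  have en1 : (0 < e%:num / (2 ^ n.+1)%:R)%R by [].
  have fin : lebesgue_outer (A n) \is a fin_num.
    by rewrite ge0_fin_numE// ltey; apply/eqP; exact: Aoo.
  have [_ [I AI <-] Ie] := lb_ereal_inf_adherent en1 fin.
  by exists I; split => //; exact/ltW.
pose v := ovolume \o uncurry G.
have v_ge0 x : 0 <= v x by exact: ovolume_ge0.
have sumvE : \esum_(x in setT) v x = \sum_(i <oo) \sum_(j <oo) v (i, j).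
  pose J : nat -> set (nat * nat) := fun i => [set (i, j) | j in setT].
  rewrite (_ : setT = \bigcup_k J k); last first.
    by rewrite predeqE => -[a b]; split => // _; exists a => //; exists b.
  rewrite esum_bigcupT//=; last first.
    apply/trivIsetP => i j _ _ ij.
    rewrite predeqE => -[n m] /=; split => //= -[] [_] _ [<-{n} _].
    by move=> [m' _] [] /esym/eqP; rewrite (negbTE ij).
  rewrite -(image_id [set: nat]) -fun_true esum_pred_image//; last first.
    by move=> n _; exact: esum_ge0.
  apply: eq_eseriesr => /= j _.
  rewrite -(esum_pred_image v (pair j) predT)//=; last first.
    by move=> ? ? _ _; exact: (@can_inj _ _ _ snd).
  by congr esum; rewrite predeqE => -[a b]; split; move=> [i _ <-]; exists i.
apply: (@le_trans _ _ (\esum_(x in setT) v x)).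
  apply: ereal_inf_lbound => /=.
  have /card_esym/ppcard_eqP[g] := card_nat2.
  exists (uncurry G \o g).
    move=> t [n _ /(PG n).1 [k _ Gnk]].
    by exists (g^-1%FUN (n, k)) => //=; rewrite invK ?inE.
  rewrite -(esum_pred_image v _ xpredT) ?[fun=> _]set_true//.
  by rewrite image_eq.
rewrite sumvE; apply: lee_nneseries => [n _|n _]; last exact: (PG n).2.
by move=> _; apply: nneseries_ge0.
Qed.

HB.instance Definition _ := isOuterMeasure.Build R _ lebesgue_outer
  lebesgue_outer0 lebesgue_outer_ge0 le_lebesgue_outer
  lebesgue_outer_sigma_subadditive.

Definition Rd : Type := caratheodory_type lebesgue_outer.

HB.instance Definition _ := Measurable.on Rd.

Definition leb : set Rd -> \bar R := lebesgue_outer.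

HB.instance Definition _ := isMeasure.Build _ Rd R leb
  (@caratheodory_measure0 _ _ lebesgue_outer)
  (@caratheodory_measure_ge0 _ _ lebesgue_outer)
  (@caratheodory_measure_sigma_additive _ _ lebesgue_outer).

End lebesgue_measure_Rd.

Arguments Rd R d : clear implicits.
Arguments leb R d : clear implicits.

Definition enorm {R : realType} {d : nat} (x : Rd R d) : R :=
  Num.sqrt (\sum_(i < d) (x : 'rV[R]_d) ord0 i ^+ 2)%R.

Definition eball0 {R : realType} {d : nat} (r : R) : set (Rd R d) :=
  [set y | (enorm y < r)%R].

Section rearrangements.
Context {R : realType} {dT : measure_display} {T : measurableType dT}.
Variables (mu : {measure set T -> \bar R}) (Omega : set T).
Implicit Types (q f g : T -> \bar R) (sigma : T -> R).

(* Functions of L^1 take values in [\bar R]: rearrangements may be infinite on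
   a null set. *)
Definition nonneg_L1 q :=
  (forall x, Omega x -> 0 <= q x) /\ mu.-integrable Omega q.

Definition distr q (t : R) : \bar R :=
  mu (Omega `&` [set x | t%:E < q x]).

Definition equimeasurable f g :=
  forall t : R, (0 <= t)%R -> distr f t = distr g t.

(* [ereal_inf set0 = +oo] and [distr q t <= +oo] make this formula cover the
   conventions q^sharp(0) = ||q||_oo and q^sharp(+oo) = 0. *)
Definition sharp q (s : \bar R) : \bar R :=
  ereal_inf [set t%:E | t in [set t : R | (0 <= t)%R /\ distr q t <= s]].

Definition sublevel_meas sigma (e : R) : \bar R :=
  mu (Omega `&` [set x | (sigma x < e)%R]).

(* ess inf over Omega: outside Omega the function is given the value +oo. *)
Definition e_min sigma : \bar R :=
  ess_inf mu (fun x => if x \in Omega then (sigma x)%:E else +oo).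

Definition e_max sigma : \bar R :=
  ereal_sup [set e%:E | e in [set e : R | sublevel_meas sigma e < mu Omega]].

Definition left_of (l : \bar R) : set_system R :=
  match l with
  | e%:E => e^'-
  | +oo => pinfty_nbhs R
  | -oo => [set: set R]
  end.

Definition admissible sigma :=
  [/\ measurable_fun Omega sigma,
      [set e : R | sublevel_meas sigma e < mu Omega] !=set0,
      e_min sigma < e_max sigma,
      (forall e : R, e%:E < e_max sigma ->
        mu (Omega `&` [set x | sigma x = e]) = 0) &
      sublevel_meas sigma e @[e --> left_of (e_max sigma)] --> mu Omega].

Definition sigma_rearr sigma f (x : T) : \bar R :=
  if (sigma x)%:E < e_max sigma then sharp f (sublevel_meas sigma (sigma x))
  else 0.

Definition nonincreasing_of sigma g :=
  exists F : R -> \bar R,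
    nonincreasing_fun F /\ forall x, Omega x -> g x = F (sigma x).

End rearrangements.

Definition symm_rearr {R : realType} {d : nat} (Omega : set (Rd R d))
    (q : Rd R d -> \bar R) (x : Rd R d) : \bar R :=
  sharp (leb R d) Omega q (leb R d (eball0 (enorm x) `&` Omega)).

(* Main.v *)
(** Superlevel sets of a nonincreasing function of [sigma] are of the form
    [sigma \in J] with [J] a down-set of the line. The function [a_sigma] is
    nondecreasing, tends to 0 at [-oo] and to [mu Omega] at [e_max], and it is
    continuous below [e_max] since the level sets of [sigma] there are null; by
    the intermediate value property [{a_sigma(sigma) < m}] has measure exactly
    [m]. As [f^sharp(s) > t] iff [mu_f(t) > s], this gives equimeasurability.
    For uniqueness, superlevel sets of two nonincreasing functions of [sigma]
    are nested, so when they have the same finite measure they coincide up to a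
    null set; it remains to let the level range over the positive rationals. *)
Require Import Defs.
From HB Require Import structures.
From mathcomp Require Import all_boot all_order all_algebra.
From mathcomp Require Import all_classical all_reals all_analysis.
From mathcomp Require Import lra measurable_realfun.

Set Implicit Arguments.
Unset Strict Implicit.
Unset Printing Implicit Defensive.

Import Order.TTheory GRing.Theory Num.Theory.
Import numFieldNormedType.Exports.

Local Open Scope classical_set_scope.
Local Open Scope ring_scope.
Local Open Scope ereal_scope.

(** * Separation by rationals and measurability of monotone functions *)

Lemma ereal_rat_between (R : realType) (x y : \bar R) :
  x < y -> exists q : rat, x < (ratr q)%:E < y.
Proof.
have bnd (a b : R) : (a < b)%R -> exists q : rat, a%:E < (ratr q)%:E < b%:E.
  move=> /rat_in_itvoo[q]; rewrite in_itv/= => qab.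
  by exists q; rewrite !lte_fin.
case: x y => [x| |] [y| |]//.
- by rewrite lte_fin => /bnd.
- have /bnd[q /andP[xq _]] : (x < x + 1)%R by rewrite ltrDl.
  by exists q; rewrite xq ltry.
- have /bnd[q /andP[_ qy]] : (y - 1 < y)%R by rewrite gtrBl.
  by exists q; rewrite ltNyr qy.
- by move=> _; exists 0%R; rewrite ltNyr ltry.
Qed.

(** Superlevel sets of [F] are down-sets of the line, hence intervals. *)
Lemma nonincreasing_emeasurable (R : realType) (F : R -> \bar R) :
  nonincreasing_fun F -> measurable_fun [set: R] F.
Proof.
move=> Fni; apply: (measurability _ (ErealGenOInfty.measurableE R)) => //.
move=> _ [_ [t ->] <-].
rewrite setTI; apply: is_interval_measurable => x y /=.
rewrite !in_itv/= !andbT => tx ty z /andP[_ zy].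
by rewrite in_itv/= andbT (lt_le_trans ty)// Fni.
Qed.

(** * Distribution functions and decreasing rearrangements *)

Section distribution_function.
Context {R : realType} {dT : measure_display} {T : measurableType dT}.
Variables (mu : {measure set T -> \bar R}) (Omega : set T).
Hypothesis mOmega : measurable Omega.
Implicit Types (f g : T -> \bar R).

Lemma measurable_superlevel f (t : R) : measurable_fun Omega f ->
  measurable (Omega `&` [set x | t%:E < f x]).
Proof. by move=> mf; apply: emeasurable_fun_o_infty. Qed.

Lemma distr_nonincreasing f (s t : R) : measurable_fun Omega f ->
  (s <= t)%R -> distr mu Omega f t <= distr mu Omega f s.
Proof.
move=> mf st; apply: le_measure; rewrite ?inE; try exact: measurable_superlevel.
by move=> x [Ox /= tx]; split => //=; rewrite (le_lt_trans _ tx)// lee_fin.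
Qed.

Lemma distr_le_measure f (t : R) : measurable_fun Omega f ->
  distr mu Omega f t <= mu Omega.
Proof.
by move=> mf; apply: le_measure; rewrite ?inE//; exact: measurable_superlevel.
Qed.

(** Continuity from below: [f > t] is the increasing union of the sets [f > t + 1/(n+1)]. The gap
    between [t] and [t'] is what gives a strict inequality in [lt_sharpE]. *)
Lemma distr_right_lsc f (t : R) (s : \bar R) : measurable_fun Omega f ->
  s < distr mu Omega f t ->
  exists2 t' : R, (t < t')%R & s < distr mu Omega f t'.
Proof.
move=> mf st; pose tn (n : nat) : R := (t + n.+1%:R^-1)%R.
have ttn n : (t < tn n)%R by rewrite ltrDl.
apply: contrapT => /forall2NP H.
have : distr mu Omega f t <= s.
  pose A n := Omega `&` [set x | (tn n)%:E < f x].
  have UA : \bigcup_n A n = Omega `&` [set x | t%:E < f x].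
    apply/seteqP; split=> [x [n _ [Ox /= tx]]|x [Ox /= tx]].
      by split => //=; rewrite (lt_trans _ tx)// lte_fin.
    have [q /andP[tq qf]] := ereal_rat_between tx.
    have /ltr_add_invr[n tnq] : (t < ratr q)%R by rewrite -lte_fin.
    by exists n => //; split => //=; rewrite (lt_trans _ qf)// lte_fin.
  have mA n : measurable (A n) by exact: measurable_superlevel.
  have := @nondecreasing_cvg_mu _ _ _ mu A mA.
  rewrite UA => /(_ (measurable_superlevel t mf)).
  have ndA : {homo A : n m / (n <= m)%N >-> (n <= m)%O}.
    move=> n m nm; apply/subsetPset => x [Ox /= tx]; split => //=.
    by rewrite (le_lt_trans _ tx)// lee_fin lerD2l lef_pV2 ?posrE// ler_nat.
  move=> /(_ ndA) cA; apply: (cvge_le _ cA); apply: nearW => n /=.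
  by have [/negP|/negP] := H (tn n); rewrite ?ttn// -leNgt.
by rewrite leNgt st.
Qed.

Lemma sharp_ge0 f s : 0 <= sharp mu Omega f s.
Proof. by apply: le_ereal_inf_tmp => _ [t [t0 _] <-]; rewrite lee_fin. Qed.

Lemma sharp_nonincreasing f : nonincreasing_fun (sharp mu Omega f).
Proof.
move=> s s' ss'; apply: ereal_inf_le_tmp => _ [t [t0 fs] <-].
by exists t => //; split => //; exact: le_trans ss'.
Qed.

(** From left to right, [t] would otherwise compete in the infimum. Conversely, some [t' > t] still
    has [s < distr f t'], and by monotonicity every competitor is at least [t']. *)
Lemma lt_sharpE f (t : R) s : measurable_fun Omega f -> (0 <= t)%R ->
  (t%:E < sharp mu Omega f s) = (s < distr mu Omega f t).
Proof.
move=> mf t0; apply/idP/idP => [|].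
  rewrite !ltNge; apply: contra => ts.
  by apply: ereal_inf_lbound; exists t.
move=> /(distr_right_lsc mf)[t' tt' st'].
apply: (@lt_le_trans _ _ t'%:E); first by rewrite lte_fin.
apply: le_ereal_inf_tmp => _ [u [u0 us] <-].
rewrite lee_fin leNgt; apply/negP => ut.
have := lt_le_trans st' (distr_nonincreasing mf (ltW ut)).
by rewrite ltNge us.
Qed.

Lemma sharp_equimeasurable f g : equimeasurable mu Omega f g ->
  sharp mu Omega f = sharp mu Omega g.
Proof.
move=> fg; apply/funext => s; congr ereal_inf; apply/seteqP.
by split => _ [t [t0 ts] <-]; exists t => //; split => //; rewrite ?fg// -fg.
Qed.

(** Markov's inequality; the level must be positive since [Omega] may have infinite measure. *)
Lemma nonneg_L1_distr_lty f (t : R) : nonneg_L1 mu Omega f -> (0 < t)%R ->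
  distr mu Omega f t < +oo.
Proof.
move=> [f0 /integrableP[mf intf]] t0.
have := @le_integral_comp_abse _ _ _ mu _ mOmega f t id
  (@measurable_id _ _ _) (fun r r0 => r0) (fun x y _ _ xy => xy) mf t0.
move=> /le_lt_trans/(_ intf) H.
have mA : measurable (Omega `&` [set x | t%:E <= `|f x|]).
  by apply: emeasurable_fun_c_infty => //; exact: measurableT_comp.
apply: (@le_lt_trans _ _ (mu (Omega `&` [set x | t%:E <= `|f x|]))).
  apply: le_measure; rewrite ?inE//; first exact: measurable_superlevel.
  by move=> x [Ox /= tx]; split => //=; rewrite gee0_abs ?f0// ltW.
rewrite ltey; apply/eqP => Aoo; move: H.
by rewrite Aoo gt0_muley// ltexx.
Qed.

End distribution_function.

(* Riemann sum of [\int_0^oo 1_(t < y) dt] over [m] steps of length [1/(n+1)].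
   With Fatou's lemma these sums replace the layer cake formula, whose proof by
   Tonelli's theorem would need [mu] to be sigma-finite. *)
Definition staircase {R : realType} (n m : nat) (y : \bar R) : \bar R :=
  \sum_(k < m) if (k.+1%:R / n.+1%:R)%:E < y then (n.+1%:R^-1)%:E else 0.

(** * Comparison of integrals of equimeasurable functions by Riemann sums *)

Section staircase.
Context {R : realType}.
Implicit Types (n m : nat) (y : \bar R).

Lemma staircaseS n m y : staircase n m.+1 y = staircase n m y +
  if (m.+1%:R / n.+1%:R)%:E < y then (n.+1%:R^-1)%:E else 0.
Proof. by rewrite /staircase big_ord_recr. Qed.

Lemma staircase_ge0 n m y : 0 <= staircase n m y.
Proof.
by apply: sume_ge0 => k _; case: ifP => // _; rewrite lee_fin invr_ge0.
Qed.

(** The second bound drives the induction: if the new threshold [(m+1)/(n+1)] lies below [y], it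
    also dominates the new sum. *)
Lemma staircase_le n m y : 0 <= y ->
  staircase n m y <= y /\ staircase n m y <= (m%:R / n.+1%:R)%:E.
Proof.
move=> y0; elim: m => [|m [IH1 IH2]].
  by rewrite /staircase big_ord0 mul0r.
rewrite staircaseS; case: ifPn => h; last first.
  rewrite adde0; split => //; apply: (le_trans IH2).
  by rewrite lee_fin ler_pM2r// ler_nat.
suff H : staircase n m y + (n.+1%:R^-1)%:E <= (m.+1%:R / n.+1%:R)%:E.
  by split => //; exact: le_trans (ltW h).
apply: (le_trans (leeD2r _ IH2)).
by rewrite -EFinD lee_fin -[m.+1%:R]natr1 mulrDl mul1r.
Qed.

(** Either the new step counts and the bound grows with it, or [t <= y <= (m+1)/(n+1)], and then the
    minimum is already [t - 1/(n+1)]. *)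
Lemma staircase_ge n m y (t : R) : t%:E <= y ->
  (Num.min (t - n.+1%:R^-1) (m%:R / n.+1%:R))%:E <= staircase n m y.
Proof.
move=> ty; elim: m => [|m IH].
  by rewrite /staircase big_ord0 mul0r lee_fin ge_min lexx orbT.
rewrite staircaseS; case: ifPn => h.
  apply: le_trans (leeD2r _ IH); rewrite -EFinD lee_fin.
  have n0 : (0 < n.+1%:R^-1 :> R)%R by rewrite invr_gt0.
  rewrite -[m.+1%:R]natr1 mulrDl mul1r.
  by rewrite addr_minl subrK le_min !ge_min lexx orbT gerBl ltW.
rewrite adde0; apply: le_trans IH; rewrite lee_fin le_min !ge_min lexx /=.
have : (t <= m.+1%:R / n.+1%:R)%R by rewrite -lee_fin (le_trans ty)// leNgt.
by rewrite -[m.+1%:R]natr1 mulrDl mul1r -lerBlDr => ->.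
Qed.

(** With [(n+1)^2] steps the mesh [1/(n+1)] tends to 0 while the range [n+1] tends to infinity, so
    that [y = +oo] is reached too. *)
Lemma limn_einf_staircase y : 0 <= y ->
  y <= limn_einf (fun n => staircase n (n.+1 * n.+1) y).
Proof.
(* Two rationals [t < t'] are placed between the lower limit and [y]; the gap [t' - t] absorbs the
   mesh. *)
move=> y0; rewrite leNgt; apply/negP => /ereal_rat_between[q /andP[lq]].
set t := ratr q in lq * => /ereal_rat_between[q' /andP[]].
set t' := ratr q'; rewrite lte_fin => tt' t'y.
suff : t%:E <= limn_einf (fun n => staircase n (n.+1 * n.+1) y).
  by rewrite leNgt lq.
have /ltr_add_invr[k kt] := tt'.
rewrite limn_einf_lim; apply: lime_ge; first exact: is_cvg_einfs.
near=> n.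
apply: le_ereal_inf_tmp => _ [p /= np <-].
apply: le_trans (staircase_ge p (p.+1 * p.+1) (ltW t'y)).
rewrite lee_fin le_min; apply/andP; split.
  rewrite lerBrDr (le_trans _ (ltW kt))// lerD2l lef_pV2 ?posrE// ler_nat ltnS.
  by rewrite (leq_trans _ np)//; near: n; exists k.
rewrite natrM mulfK// (le_trans (ltW (truncnS_gt t)))// ler_nat ltnS.
by rewrite (leq_trans _ np)//; near: n; exists (Num.truncn t).
Unshelve. all: by end_near. Qed.

Context {dT : measure_display} {T : measurableType dT}.
Variables (mu : {measure set T -> \bar R}) (Omega : set T).
Hypothesis mOmega : measurable Omega.
Implicit Types (f g : T -> \bar R).

Lemma staircase_indicE n m f x : Omega x -> staircase n m (f x) =
  \sum_(k < m) (n.+1%:R^-1)%:E *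
    (\1_(Omega `&` [set z : T | ((k.+1%:R / n.+1%:R)%:E < f z)%E]) x)%:E.
Proof.
move=> Ox; apply: eq_bigr => k _; rewrite indicE; case: ifPn => h.
  by rewrite mem_set ?mule1.
by rewrite memNset ?mule0// => -[_ /=]; exact/negP.
Qed.

Lemma measurable_staircase n m f : measurable_fun Omega f ->
  measurable_fun Omega (fun x => staircase n m (f x)).
Proof.
move=> mf; apply: eq_measurable_fun => [x /[!inE] Ox|].
  by rewrite staircase_indicE.
apply: emeasurable_sum => k; apply: measurable_funeM.
by apply/measurable_EFinP/measurable_indic/measurable_superlevel.
Qed.

Lemma integral_staircase n m f : measurable_fun Omega f ->
  \int[mu]_(x in Omega) staircase n m (f x) =
  \sum_(k < m) (n.+1%:R^-1)%:E * distr mu Omega f (k.+1%:R / n.+1%:R).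
Proof.
move=> mf; under eq_integral => x /[!inE] Ox do rewrite staircase_indicE//.
have mA (k : 'I_m) := measurable_superlevel mOmega (k.+1%:R / n.+1%:R)%R mf.
have mI (k : 'I_m) : measurable_fun Omega (fun x =>
    (\1_(Omega `&` [set z : T | ((k.+1%:R / n.+1%:R)%:E < f z)%E]) x)%:E
      : \bar R).
  exact/measurable_EFinP/measurable_indic.
rewrite ge0_integral_sum//.
- apply: eq_bigr => k _; rewrite ge0_integralZl//.
  + by rewrite integral_indic// setIAC setIid.
- by move=> k; exact: measurable_funeM.
Qed.

(** Integrals of staircases depend only on the distribution function. Fatou's lemma bounds the
    integral of [g] by theirs, and each staircase of [f] lies below [f]. *)
Lemma equimeasurable_integral_le f g :
  measurable_fun Omega f -> measurable_fun Omega g ->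
  (forall x, Omega x -> 0 <= f x) -> (forall x, Omega x -> 0 <= g x) ->
  equimeasurable mu Omega f g ->
  \int[mu]_(x in Omega) g x <= \int[mu]_(x in Omega) f x.
Proof.
move=> mf mg f0 g0 fg; pose N n := (n.+1 * n.+1)%N.
apply: (@le_trans _ _
    (\int[mu]_(x in Omega) limn_einf (fun n => staircase n (N n) (g x)))).
  apply: ge0_le_integral => //.
  - apply: measurableT_comp => //; apply: measurable_fun_limn_esup => n.
    by apply: measurableT_comp => //; exact: measurable_staircase.
  - by move=> x Ox; exact/limn_einf_staircase/g0.
apply: (le_trans (fatou mu mOmega
    (f := fun n x => staircase n (N n) (g x)) _ _)) => [n|n x _|].
- exact: measurable_staircase.
- exact: staircase_ge0.
rewrite limn_einf_lim; apply: lime_le; first exact: is_cvg_einfs.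
apply: nearW => n; apply: (@le_trans _ _
   (\int[mu]_(x in Omega) staircase n (N n) (g x))).
  by apply: ereal_inf_lbound; exists n => /=.
rewrite integral_staircase//.
under eq_bigr do rewrite -fg ?divr_ge0//.
rewrite -integral_staircase//; apply: ge0_le_integral => //.
- by move=> x _; exact: staircase_ge0.
- exact: measurable_staircase.
- by move=> x /f0 /(staircase_le n (N n)) [].
Qed.

End staircase.

(** * Uniqueness among nonincreasing functions of [sigma] *)

Section sigma_rearrangement.
Context {R : realType} {dT : measure_display} {T : measurableType dT}.
Variables (mu : {measure set T -> \bar R}) (Omega : set T).
Hypothesis mOmega : measurable Omega.
Implicit Types (f g : T -> \bar R).

(** Two down-sets of the line are comparable: if [e] lies in that of [F] but not in that of [G],
    then the latter lies entirely to the left of [e]. *)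
Lemma superlevel_nested (sigma : T -> R) f g (t : R) :
  nonincreasing_of Omega sigma f -> nonincreasing_of Omega sigma g ->
  let A h := Omega `&` [set x | t%:E < h x] in
  A f `<=` A g \/ A g `<=` A f.
Proof.
move=> [F [Fni fF]] [G [Gni gG]] A.
have [|/existsNP[e]] := pselect (forall e : R, t%:E < F e -> t%:E < G e).
  by move=> FG; left => x [Ox /= tx]; split => //=; rewrite gG// FG// -fF.
move=> /not_implyP[tF /negP tG]; right => x [Ox /= tx]; split => //=.
rewrite fF// (lt_le_trans tF)// Fni// leNgt; apply/negP => ex.
by move: tG; rewrite (lt_le_trans tx)// gG// Gni// ltW.
Qed.

Lemma nonincreasing_of_unique (sigma : T -> R) f g :
  nonneg_L1 mu Omega f -> nonneg_L1 mu Omega g ->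
  nonincreasing_of Omega sigma f -> nonincreasing_of Omega sigma g ->
  equimeasurable mu Omega f g ->
  {ae mu, forall x, Omega x -> f x = g x}.
Proof.
move=> f1 g1 fs gs fg.
have mf : measurable_fun Omega f by case: f1 => _ /integrableP[].
have mg : measurable_fun Omega g by case: g1 => _ /integrableP[].
pose A (h : T -> \bar R) (q : rat) := Omega `&` [set x | (ratr q)%:E < h x].
pose D q := (A f q `\` A g q) `|` (A g q `\` A f q).
pose P (q : rat) := (0 < ratr q :> R)%R.
have mA h q : measurable_fun Omega h -> measurable (A h q).
  exact: measurable_superlevel.
(* If [A k q] is the smaller set the difference is empty; otherwise its measure is a difference of
   equal finite numbers. *)
have null (h k : T -> \bar R) q : P q ->
    measurable_fun Omega h -> measurable_fun Omega k ->
    A h q `<=` A k q \/ A k q `<=` A h q -> nonneg_L1 mu Omega k ->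
    distr mu Omega h (ratr q) = distr mu Omega k (ratr q) ->
    mu.-negligible (A k q `\` A h q).
  move=> q0 mh mk hk k1 hkE.
  apply/negligibleP; first exact: measurableD (mA _ _ mk) (mA _ _ mh).
  case: hk => [hk|]; last by rewrite -setD_eq0 => ->; rewrite measure0.
  have fin : mu (A k q) < +oo := nonneg_L1_distr_lty mOmega k1 q0.
  rewrite (measureD (mA _ _ mk) (mA _ _ mh) fin) setIC (setIidl hk).
  rewrite [X in _ - X](_ : _ = mu (A k q)); last exact: hkE.
  by rewrite subee// ge0_fin_numE.
have nullD q : P q -> mu.-negligible (D q).
  move=> q0; have fgq := fg _ (ltW q0).
  apply: negligibleU; apply: null => //.
  - exact: (superlevel_nested (ratr q) gs fs).
  - exact: (superlevel_nested (ratr q) fs gs).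
(* The rationals are enumerated by [unpickle]; indices that code no positive rational contribute
   [set0]. *)
apply: (@negligibleS _ _ _ mu (\bigcup_n
    (if unpickle n is Some q then if `[< P q >] then D q else set0 else set0))).
  move=> x /= /not_implyP[Ox /eqP].
  (* A rational strictly between the two values exceeds the smaller one, which is nonnegative, so it
     is positive. *)
  rewrite neq_lt => /orP[|] /ereal_rat_between[q /andP[h1 h2]].
  - exists (pickle q); [by []|rewrite pickleK; case: asboolP => [_|]]; last first.
      by case; rewrite /P -lte_fin (le_lt_trans _ h1)//; case: f1 => + _; exact.
    by right; split; [split | case => _ /=; apply/negP; rewrite -leNgt ltW].
  - exists (pickle q); [by []|rewrite pickleK; case: asboolP => [_|]]; last first.
      by case; rewrite /P -lte_fin (le_lt_trans _ h1)//; case: g1 => + _; exact.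
    by left; split; [split | case => _ /=; apply/negP; rewrite -leNgt ltW].
apply: negligible_bigcup => n.
case: (unpickle n) => [q|]; last exact: negligible_set0.
by case: asboolP => [/nullD//|_]; exact: negligible_set0.
Qed.

(** * Monotonicity, limits and intermediate values of [a] *)

Section admissible.
Variable sigma : T -> R.
Hypothesis adm : admissible mu Omega sigma.
Let M := mu Omega.
Let E := e_max mu Omega sigma.
Let a := sublevel_meas mu Omega sigma.
Let msigma : measurable_fun Omega sigma. Proof. by case: adm. Qed.

Let mlt e : measurable (Omega `&` [set x | (sigma x < e)%R]).
Proof.
rewrite (_ : [set x | _] = sigma @^-1` `]-oo, e[%classic).
  exact: msigma.
by apply/seteqP; split => x /=; rewrite in_itv.
Qed.

Lemma sublevel_meas_nondecreasing (e e' : R) : (e <= e')%R -> a e <= a e'.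
Proof.
move=> ee'; apply: le_measure; rewrite ?inE//.
by move=> x [Ox /= xe]; split => //=; exact: lt_le_trans ee'.
Qed.

Lemma sublevel_meas_lt (e : R) : e%:E < E -> a e < M.
Proof.
move=> /ereal_sup_gt[_ [e' ae' <-]]; rewrite lte_fin => /ltW ee'.
exact: le_lt_trans (sublevel_meas_nondecreasing ee') ae'.
Qed.

(** This holds even if [Omega] has infinite measure, and permits continuity from above of [mu] below
    [E]. *)
Lemma sublevel_meas_lty (e : R) : e%:E < E -> a e < +oo.
Proof. by move=> /sublevel_meas_lt h; rewrite (lt_le_trans h)// leey. Qed.

Lemma measure_sublevel_le (e : R) : e%:E < E ->
  mu (Omega `&` [set x | (sigma x <= e)%R]) = a e.
Proof.
move=> eE; have [_ _ _ /(_ e eE) h _] := adm.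
have -> : Omega `&` [set x | (sigma x <= e)%R] =
    (Omega `&` [set x | (sigma x < e)%R]) `|` (Omega `&` [set x | sigma x = e]).
  rewrite -setIUr; congr (_ `&` _); apply/seteqP; split => x /=.
    by rewrite le_eqVlt => /orP[/eqP|]; [right|left].
  by case=> [/ltW//|->].
rewrite measureU0//.
rewrite (_ : [set x | _] = sigma @^-1` [set e])//; exact: msigma.
Qed.

Lemma sublevel_meas_lim_le (c : \bar R) :
  (forall e : R, e%:E < E -> a e <= c) -> M <= c.
Proof.
move=> ac; have [_ [e0 ae0] _ _] := adm.
have e0E : e0%:E <= E by apply: ereal_sup_ubound; exists e0.
(* The point [e0] rules out [E = -oo]. *)
rewrite -/E -/a -/M; case: E e0E ac => [r| |]//= _ ac cM.
- apply: (cvge_le _ cM); near=> e; apply: ac; rewrite lte_fin.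
  by near: e; exact: nbhs_left_lt.
- by apply: (cvge_le _ cM); near=> e; apply: ac; rewrite ltry.
Unshelve. all: by end_near. Qed.

(** The set contains every [sigma < e] with [e] below [E], and the measures of these tend to [M]. *)
Lemma measure_lt_e_max : mu (Omega `&` [set x | (sigma x)%:E < E]) = M.
Proof.
have mE : measurable (Omega `&` [set x | (sigma x)%:E < E]).
  by apply: emeasurable_fun_infty_o => //; exact/measurable_EFinP.
apply/eqP; rewrite eq_le; apply/andP; split.
  by apply: le_measure; rewrite ?inE//; exact: subIsetl.
apply: sublevel_meas_lim_le => e eE; apply: le_measure; rewrite ?inE//.
by move=> x [Ox /= xe]; split => //=; rewrite (lt_trans _ eE)// lte_fin.
Qed.

(** For [m = distr f t] with [t >= 0], this set is where the rearrangement of [f] exceeds [t]. *)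
Lemma measure_sublevel_meas_lt (m : \bar R) : 0 <= m <= M ->
  mu (Omega `&` [set x | (sigma x)%:E < E /\ a (sigma x) < m]) = m.
Proof.
move=> /andP[]; rewrite le_eqVlt => /predU1P[<- _|m0 mM].
  rewrite (_ : _ `&` _ = set0) ?measure0//; apply/seteqP; split => // x [_ [_]].
  by rewrite ltNge measure_ge0.
have [Jall|/existsNP[e1 /not_implyP[e1E /negP]]] :=
    pselect (forall e : R, e%:E < E -> a e < m).
  have -> : m = M.
    apply/eqP; rewrite eq_le mM/=.
    by apply: sublevel_meas_lim_le => e /Jall/ltW.
  rewrite -[RHS]measure_lt_e_max; congr (mu (_ `&` _)); apply/seteqP.
  split => x /=; first by case.
  by move=> xE; split => //; exact: sublevel_meas_lt.
rewrite -leNgt => me1.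
pose J := [set e : R | e%:E < E /\ a e < m].
have J_lt_e1 e : J e -> (e < e1)%R.
  move=> [_ am]; rewrite ltNge; apply/negP => /sublevel_meas_nondecreasing.
  by move=> /(le_trans me1); rewrite leNgt am.
have J0 : J !=set0.
  apply: contrapT => J0.
  (* Otherwise [a >= m > 0] all the way down to [-oo], where [a] tends to 0. *)
  have am n : m <= a (e1 - n%:R)%R.
    rewrite leNgt; apply/negP => am; apply: J0.
    exists (e1 - n%:R)%R; split => //.
    by rewrite (le_lt_trans _ e1E)// lee_fin gerBl.
  pose B n := Omega `&` [set x | (sigma x < e1 - n%:R)%R].
  have mB n : measurable (B n) by exact: mlt.
  have B0 : \bigcap_n B n = set0.
    apply/seteqP; split => // x /= Bx.
    have [_ /=] := Bx (Num.truncn (e1 - sigma x)).+1 I.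
    by have := truncnS_gt (e1 - sigma x); lra.
  have : mu (B n) @[n --> \oo] --> mu (\bigcap_n B n).
    apply: nonincreasing_cvg_mu => //.
    - by rewrite /B subr0; exact: sublevel_meas_lty.
    - exact: bigcapT_measurable.
    - move=> n k nk; apply/subsetPset => x [Ox /= xk]; split => //=.
      by rewrite (lt_le_trans xk)// lerD2l lerN2 ler_nat.
  rewrite B0 measure0 => B_cvg.
  have : m <= 0 by apply: (cvge_ge _ B_cvg); exact: nearW.
  by rewrite leNgt m0.
have hsJ : has_sup J by split => //; exists e1 => e /J_lt_e1/ltW.
(* Once [a e0 = m] is known, [J] is exactly the open half-line below [e0], and the set to be
   measured is [sigma < e0]. *)
pose e0 := sup J.
have e0E : e0%:E < E.
  by rewrite (le_lt_trans _ e1E)// lee_fin ge_sup// => e /J_lt_e1/ltW.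
have lt_e0 e : (e < e0)%R -> J e.
  move=> /(sup_gt J0)[e' [e'E ae'm] ee']; split.
    by rewrite (lt_trans _ e'E)// lte_fin.
  exact: le_lt_trans (sublevel_meas_nondecreasing (ltW ee')) ae'm.
(* [<=] is left continuity of [a], [>=] right continuity. *)
have ae0m : a e0 = m.
  apply/eqP; rewrite eq_le; apply/andP; split.
    pose B n := Omega `&` [set x | (sigma x < e0 - n.+1%:R^-1)%R].
    have mB n : measurable (B n) by exact: mlt.
    have BE : \bigcup_n B n = Omega `&` [set x | (sigma x < e0)%R].
      apply/seteqP; split => x.
        move=> [n _ [Ox /= xe]]; split => //=; rewrite (lt_trans xe)//.
        by rewrite gtrBl invr_gt0.
      move=> [Ox /= /ltr_add_invr[n xe]]; exists n => //; split => //=.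
      by rewrite ltrBrDr.
    have : mu (B n) @[n --> \oo] --> mu (\bigcup_n B n).
      apply: nondecreasing_cvg_mu => //; first exact: bigcupT_measurable.
      move=> n k nk; apply/subsetPset => x [Ox /= xk]; split => //=.
      by rewrite (lt_le_trans xk)// lerD2l lerN2 lef_pV2 ?posrE// ler_nat.
    rewrite BE => B_cvg; apply: (cvge_le _ B_cvg); apply: nearW => n.
    have [_ /ltW//] : J (e0 - n.+1%:R^-1)%R.
    by apply: lt_e0; rewrite gtrBl invr_gt0.
  have [e2 /andP[e02 e2E]] : exists e2 : R, e0%:E < e2%:E < E.
    by have [q] := ereal_rat_between e0E; exists (ratr q).
  rewrite lte_fin in e02.
  (* The step [(e2 - e0)/(n+1)] keeps every bound at most [e2], hence below [E]; [B 0] is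
     [sigma < e2], of finite measure. *)
  pose B n := Omega `&` [set x | (sigma x < e0 + (e2 - e0) / n.+1%:R)%R].
  have mB n : measurable (B n) by exact: mlt.
  have d0 n : (0 < (e2 - e0) / n.+1%:R)%R by rewrite divr_gt0// subr_gt0.
  have BE : \bigcap_n B n = Omega `&` [set x | (sigma x <= e0)%R].
    apply/seteqP; split => x.
      move=> Bx; split; first by case: (Bx 0%N I).
      apply/ler_addgt0Pl => /= eps eps0; rewrite addrC.
      have := truncnS_gt ((e2 - e0) / eps); set n := Num.truncn _ => neps.
      have [_ /= /ltW] := Bx n I; move=> /le_trans; apply.
      rewrite lerD2l ler_pdivrMr// mulrC -ler_pdivrMr//; exact: ltW.
    move=> [Ox /= xe] n _; split => //=; rewrite (le_lt_trans xe)//.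
    by rewrite ltrDl.
  rewrite -measure_sublevel_le//.
  have : mu (B n) @[n --> \oo] --> mu (\bigcap_n B n).
    apply: nonincreasing_cvg_mu => //.
    - by rewrite /B divr1 addrC subrK; exact: sublevel_meas_lty.
    - exact: bigcapT_measurable.
    - move=> n k nk; apply/subsetPset => x [Ox /= xk]; split => //=.
      rewrite (lt_le_trans xk)// lerD2l ler_pM2l ?subr_gt0//.
      by rewrite lef_pV2 ?posrE// ler_nat.
  rewrite BE => B_cvg; apply: (cvge_ge _ B_cvg); apply: nearW => n.
  (* A value of [a] below [m] would put a point beyond [e0] into [J]. *)
  have [//|am] := leP m (a (e0 + (e2 - e0) / n.+1%:R)%R).
  have : J (e0 + (e2 - e0) / n.+1%:R)%R.
    split => //; rewrite (le_lt_trans _ e2E)// lee_fin -lerBrDl.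
    by rewrite ler_pdivrMr// ler_peMr ?subr_ge0 ?(ltW e02)// ler1n.
  by move=> /(ub_le_sup hsJ.2); rewrite -/e0 gerDl leNgt d0.
rewrite -[RHS]ae0m; congr (mu (_ `&` _)); apply/seteqP; split => x /=.
  move=> [xE axm]; rewrite ltNge; apply/negP => /sublevel_meas_nondecreasing.
  by rewrite ae0m leNgt axm.
exact: lt_e0.
Qed.

(** * Properties of the rearrangement of [f] *)

Variable f : T -> \bar R.
Hypothesis f1 : nonneg_L1 mu Omega f.
Let fs := sigma_rearr mu Omega sigma f.
Let mf : measurable_fun Omega f. Proof. by case: f1 => _ /integrableP[]. Qed.

Lemma sigma_rearr_nonincreasing_of : nonincreasing_of Omega sigma fs.
Proof.
exists (fun e => if e%:E < E then sharp mu Omega f (a e) else 0); split => //.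
move=> e e' ee'; case: ifPn => e'E; last by case: ifP => // _; exact: sharp_ge0.
rewrite (le_lt_trans _ e'E) ?lee_fin//.
exact/sharp_nonincreasing/sublevel_meas_nondecreasing.
Qed.

Lemma sigma_rearr_ge0 x : 0 <= fs x.
Proof. by rewrite /fs /sigma_rearr; case: ifP => // _; exact: sharp_ge0. Qed.

Lemma measurable_sigma_rearr : measurable_fun Omega fs.
Proof.
have [F [Fni fF]] := sigma_rearr_nonincreasing_of.
apply: (eq_measurable_fun (F \o sigma)) => [x /[!inE] /fF//|].
exact: measurableT_comp (nonincreasing_emeasurable Fni) msigma.
Qed.

Lemma sigma_rearr_equimeasurable : equimeasurable mu Omega f fs.
Proof.
(* The number [distr f t] is rewritten as the measure of the set where [a (sigma x)] lies below
   it. *)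
move=> t t0; rewrite -[LHS]measure_sublevel_meas_lt; last first.
  by rewrite measure_ge0 distr_le_measure.
congr (mu (_ `&` _)); apply/seteqP; split => x /=; rewrite /fs /sigma_rearr.
  by move=> [-> ?]; rewrite lt_sharpE.
case: ifPn => xE; first by rewrite lt_sharpE.
(* At or beyond [E] the rearrangement is 0, which does not exceed [t >= 0]. *)
by rewrite lte_fin ltNge t0.
Qed.

Lemma sigma_rearr_nonneg_L1 : nonneg_L1 mu Omega fs.
Proof.
have [f0 /integrableP[_ intf]] := f1.
split => [x _|]; first exact: sigma_rearr_ge0.
apply/integrableP; split; first exact: measurable_sigma_rearr.
under eq_integral do rewrite gee0_abs ?sigma_rearr_ge0//.
apply: le_lt_trans intf.
under [leRHS]eq_integral => x /[!inE] Ox do rewrite gee0_abs ?f0//.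
apply: equimeasurable_integral_le => //.
- exact: measurable_sigma_rearr.
- by move=> x _; exact: sigma_rearr_ge0.
- exact: sigma_rearr_equimeasurable.
Qed.

End admissible.
End sigma_rearrangement.

Theorem proposition1 (R : realType) (d : nat) (d_ge1 : (1 <= d)%N)
    (Omega : set (Rd R d)) (mOmega : measurable Omega)
    (sigma : Rd R d -> R) (adm : admissible (leb R d) Omega sigma)
    (f : Rd R d -> \bar R) (hf : nonneg_L1 (leb R d) Omega f) :
  let mu := leb R d in
  let fs := sigma_rearr mu Omega sigma f in
  [/\ (forall x, Omega x -> symm_rearr Omega f x = symm_rearr Omega fs x),
      equimeasurable mu Omega f fs,
      nonneg_L1 mu Omega fs,
      nonincreasing_of Omega sigma fs &
      forall g : Rd R d -> \bar R,
        nonneg_L1 mu Omega g ->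
        nonincreasing_of Omega sigma g ->
        equimeasurable mu Omega g f ->
        {ae mu, forall x, Omega x -> g x = fs x}].
Proof.
move=> mu fs.
have fE : equimeasurable mu Omega f fs by exact: sigma_rearr_equimeasurable.
have f1 : nonneg_L1 mu Omega fs by exact: sigma_rearr_nonneg_L1.
have fni : nonincreasing_of Omega sigma fs.
  exact: sigma_rearr_nonincreasing_of.
split => //.
  by move=> x _; rewrite /symm_rearr (sharp_equimeasurable fE).
move=> g g1 gni gf; apply: (nonincreasing_of_unique mOmega g1 f1 gni fni).
by move=> t t0; rewrite gf// fE.
Qed.
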